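(* Let $k$ be a field and let $A$ be an associative $k$-algebra. Then T-isomorphism is an equivalence relation on $\mathrm{Obj}(\mathrm{Mod}(A))$ which is coarser than the module isomorphism relation (that is, isomorphic $A$-modules are T-isomorphic).
   Context: $\mathrm{Mod}(A)$ is the category of all left $A$-modules. Two $A$-modules $M_1,M_2$ are called T-isomorphic (twisted isomorphic) if there exist a $k$-algebra automorphism $f:A\to A$ and a $k$-linear isomorphism $\varphi:M_1\to M_2$ such that $f(a)\,\varphi(m)=\varphi(a\,m)$ for all $a\in A$ and $m\in M_1$. *)

(* Defs.v *)
From HB Require Import structures.
From mathcomp Require Import all_boot all_algebra.

Set Implicit Arguments.
Unset Strict Implicit.
Unset Printing Implicit Defensive.

Import GRing.Theory.
Local Open Scope ring_scope.

(* Associative unital algebras, the zero algebra included. The library's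
   [algType] builds on [nzRingType], which requires 1 != 0, and a structure
   inheriting from both [pzRingType] and [lmodType] cannot be added on top of
   its hierarchy; hence the scaling is a field of the mixin. *)
HB.mixin Record PzRing_isPzAlgebra (k : pzRingType) A of GRing.PzRing A := {
  alg_scale : k -> A -> A;
  alg_scaleA : forall a b x, alg_scale a (alg_scale b x) = alg_scale (a * b) x;
  alg_scale1r : left_id 1 alg_scale;
  alg_scaleDr : right_distributive alg_scale +%R;
  alg_scaleDl : forall x, {morph alg_scale^~ x : a b / a + b};
  alg_scaleAl : forall a (x y : A), alg_scale a (x * y) = alg_scale a x * y;
  alg_scaleAr : forall a (x y : A), alg_scale a (x * y) = x * alg_scale a y
}.

#[short(type="pzAlgType")]
HB.structure Definition PzAlgebra (k : pzRingType) :=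
  {A of GRing.PzRing A & PzRing_isPzAlgebra k A}.

HB.instance Definition _ (k : pzRingType) (A : algType k) :=
  PzRing_isPzAlgebra.Build k (GRing.Algebra.sort A)
    (@scalerA k A) (@scale1r k A) (@scalerDr k A) (fun x => scalerDl x)
    (@scalerAl k A) (@scalerAr k A).

(* An [A]-module is a [k]-module through the structure map
   [c |-> alg_scale c 1] from [k] to [A]. *)
Definition res_scalars (k : pzRingType) (A : pzAlgType k) (M : lmodType A) :
  Type := M.

Section ResScalars.
Variables (k : pzRingType) (A : pzAlgType k) (M : lmodType A).
Implicit Types (c d : k) (m : M).

Definition res_scale c m : M := alg_scale c (1 : A) *: m.

Fact res_scaleA c d m : res_scale c (res_scale d m) = res_scale (c * d) m.
Proof. by rewrite /res_scale scalerA -alg_scaleAl mul1r alg_scaleA. Qed.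

Fact res_scale1r : left_id 1 res_scale.
Proof. by move=> m; rewrite /res_scale alg_scale1r scale1r. Qed.

Fact res_scaleDr : right_distributive res_scale +%R.
Proof. by move=> c m n; rewrite /res_scale scalerDr. Qed.

Fact res_scaleDl m : {morph res_scale^~ m : c d / c + d}.
Proof. by move=> c d; rewrite /res_scale alg_scaleDl scalerDl. Qed.

HB.instance Definition _ := GRing.Zmodule.on (res_scalars M).
HB.instance Definition _ := GRing.Zmodule_isLmodule.Build k (res_scalars M)
  res_scaleA res_scale1r res_scaleDr res_scaleDl.

End ResScalars.

Definition alg_automorphism (k : pzRingType) (A : pzAlgType k)
    (f : {rmorphism A -> A}) : Prop :=
  bijective f /\ forall (c : k) (x : A), f (alg_scale c x) = alg_scale c (f x).

Definition mod_isomorphic (A : pzRingType) (M1 M2 : lmodType A) : Prop :=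
  exists phi : {linear M1 -> M2}, bijective phi.

Definition T_isomorphic (k : pzRingType) (A : pzAlgType k)
    (M1 M2 : lmodType A) : Prop :=
  exists (f : {rmorphism A -> A})
         (phi : {linear res_scalars M1 -> res_scalars M2}),
    [/\ alg_automorphism f, bijective phi &
        forall (a : A) (m : M1), f a *: (phi m : M2) = phi (a *: m)].

(* Main.v *)
Require Import Defs.
From HB Require Import structures.
From mathcomp Require Import all_boot all_algebra.
From Stdlib Require Import Relation_Definitions.

Import GRing.Theory.

(** A T-isomorphism is a pair [(f, phi)]. Such pairs compose and invert componentwise, and a module
    isomorphism is a pair with [f] the identity, which also gives reflexivity.
    [T_isomorphic_semilinear] lets such a pair be built from an additive [phi]. *)

(* The [k]-linearity of [phi] is automatic: as [f] fixes the image of [k],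
   [phi (c *: m) = f (c *: 1) *: phi m = (c *: 1) *: phi m]. *)
Lemma T_isomorphic_semilinear (k : pzRingType) (A : pzAlgType k)
    (M1 M2 : lmodType A) (f : {rmorphism A -> A}) (phi : {additive M1 -> M2}) :
  alg_automorphism f -> bijective phi ->
  (forall (a : A) (m : M1), f a *: phi m = phi (a *: m))%R ->
  T_isomorphic M1 M2.
Proof.
move=> f_aut phi_bij phi_semi.
have phi_lin : scalable (phi : res_scalars M1 -> res_scalars M2).
  (* Scaling by [c] in [res_scalars M1] unfolds to scaling by [alg_scale c 1] in [M1], so [phi_semi]
     applies to that element of [A]. *)
  move=> c m; rewrite -[LHS]phi_semi.
  by rewrite f_aut.2 rmorph1.
pose phiL := GRing.isScalable.Build k (res_scalars M1) (res_scalars M2) _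
  (phi : res_scalars M1 -> res_scalars M2) phi_lin.
pose phiA := GRing.isZmodMorphism.Build (res_scalars M1) (res_scalars M2)
  (phi : res_scalars M1 -> res_scalars M2) (raddfB phi).
pose phi' : {linear res_scalars M1 -> res_scalars M2} :=
  HB.pack (phi : res_scalars M1 -> res_scalars M2) phiA phiL.
by exists f, phi'.
Qed.

Lemma mod_isomorphic_T (k : pzRingType) (A : pzAlgType k)
    (M1 M2 : lmodType A) :
  mod_isomorphic M1 M2 -> T_isomorphic M1 M2.
Proof.
case=> phi phi_bij; apply: (@T_isomorphic_semilinear _ _ _ _ idfun phi) => //.
  by split=> //; exists id.
by move=> a m; exact: esym (linearZ_LR phi a m).
Qed.

Lemma T_isomorphic_refl (k : pzRingType) (A : pzAlgType k) :
  reflexive (lmodType A) (@T_isomorphic k A).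
Proof. by move=> M; apply: mod_isomorphic_T; exists idfun; exists id. Qed.

Lemma T_isomorphic_trans (k : pzRingType) (A : pzAlgType k) :
  transitive (lmodType A) (@T_isomorphic k A).
Proof.
move=> M1 M2 M3 [f [phi [[f_bij fZ] phi_bij phi_semi]]].
move=> [g [psi [[g_bij gZ] psi_bij psi_semi]]].
exists (g \o f), (psi \o phi); split; last 1 first.
- by move=> a m /=; rewrite psi_semi phi_semi.
- split; first exact: bij_comp.
  by move=> c x /=; rewrite fZ gZ.
- exact: bij_comp.
Qed.

(** The inverse pair [(g, psi)] is again a twisted isomorphism; its identities are checked after
    applying the injective maps [f] and [phi]. *)
Lemma T_isomorphic_sym (k : pzRingType) (A : pzAlgType k) :
  symmetric (lmodType A) (@T_isomorphic k A).
Proof.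
move=> M1 M2 [f [phi [[[g fK gK] fZ] [psi phiK psiK] phi_semi]]].
pose gB := GRing.isZmodMorphism.Build A A g (can2_zmod_morphism fK gK).
pose gM := GRing.isMonoidMorphism.Build A A g (can2_monoid_morphism fK gK).
pose g' : {rmorphism A -> A} := HB.pack g gB gM.
pose psiB := GRing.isZmodMorphism.Build M2 M1 psi
  (can2_zmod_morphism phiK psiK).
pose psi' : {additive M2 -> M1} := HB.pack (psi : M2 -> M1) psiB.
apply: (@T_isomorphic_semilinear _ _ _ _ g' psi').
- split; first by exists f.
  by move=> c x; apply: (can_inj fK); rewrite fZ !gK.
- by exists phi.
(* Under [phi], both sides become [a *: m], since [phi (g a *: psi m) = f (g a) *: phi (psi m)]. *)
move=> a m; apply: (can_inj phiK).
by rewrite -phi_semi psiK gK psiK.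
Qed.

Theorem proposition4p1 (k : fieldType) (A : pzAlgType k) :
  equivalence (lmodType A) (@T_isomorphic k A) /\
  (forall M1 M2 : lmodType A, mod_isomorphic M1 M2 -> T_isomorphic M1 M2).
Proof.
split; last exact: mod_isomorphic_T.
split.
- exact: T_isomorphic_refl.
- exact: T_isomorphic_trans.
- exact: T_isomorphic_sym.
Qed.
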